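(* Let $\Sigma$ be a non-empty alphabet, let $\Sigma^{\infty}$ be the set of all finite and infinite words on $\Sigma$, and let $q_b$ be the quasi-metric on $\Sigma^{\infty}$ given by $q_b(x,y)=2^{-\ell(x)}-2^{-\ell(y)}$ if $x$ is a prefix of $y$, and $q_b(x,y)=1$ otherwise. Then the poset of formal balls $(\mathbf{B}\Sigma^{\infty},\sqsubseteq_{q_b})$ is a domain, i.e. it is a continuous poset that is also a dcpo.
   Context: $\mathbb{R}^{+}$ denotes the set of all non-negative real numbers. Words: $\Sigma^{\infty}$ contains the empty word $\phi$. For $x\in\Sigma^{\infty}$, $\ell(x)\in\{0,1,2,\dots\}\cup\{\infty\}$ is the length of $x$ (with $\ell(\phi)=0$), and $2^{-\infty}=0$ by convention. ''$x$ is a prefix of $y$'' includes the case $x=y$. Quasi-metric: a quasi-metric on a set $X$ is a function $d:X\times X\to\mathbb{R}^{+}$ such that for all $x,y,z\in X$: (i) $x=y$ if and only if $d(x,y)=d(y,x)=0$; (ii) $d(x,y)\le d(x,z)+d(z,y)$. Formal balls: $\mathbf{B}X=X\times\mathbb{R}^{+}$ is the set of formal balls $(x,r)$ of $X$. For a quasi-metric $d$ on $X$, $\mathbf{B}X$ is partially ordered by $(x,r)\sqsubseteq_d(y,s)\iff d(x,y)\le r-s$. Domain theory: a subset $D$ of a poset is directed if it is non-empty and every finite subset of $D$ has an upper bound in $D$. A poset is a dcpo if every directed subset $D$ has a least upper bound $\sqcup D$. In a poset $(P,\sqsubseteq)$, $x$ is way below $y$, written $x\ll y$, if for each directed subset $D$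 of $P$ having a least upper bound $\sqcup D$, the relation $y\sqsubseteq\sqcup D$ implies the existence of some $u\in D$ with $x\sqsubseteq u$. The poset $P$ is continuous if for each $x\in P$ the set $\Downarrow x=\{y\in P: y\ll x\}$ is directed with least upper bound $x$. A (continuous) domain is a continuous poset which is also a dcpo. *)

(* Defs.v *)
From HB Require Import structures.
From mathcomp Require Export all_boot all_order all_algebra.
From mathcomp Require Export mathcomp_extra boolp classical_sets cardinality.
From mathcomp Require Export reals interval_inference.
From mathcomp Require Import lra.

Set Implicit Arguments.
Unset Strict Implicit.
Unset Printing Implicit Defensive.

Import Order.TTheory GRing.Theory Num.Theory.

Local Open Scope classical_set_scope.
Local Open Scope ring_scope.

Section DomainTheory.
Context {disp : Order.disp_t} {P : porderType disp}.
Implicit Types (D : set P) (x y s : P).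

Definition directed D : Prop :=
  D !=set0 /\
  forall F : set P, finite_set F -> F `<=` D -> exists2 u, D u & ubound F u.

(* [supremums D s] says that s is a least upper bound of D. *)
Definition way_below x y : Prop :=
  forall D s, directed D -> supremums D s -> (y <= s)%O ->
  exists2 u, D u & (x <= u)%O.

End DomainTheory.

Section Domains.
Context {disp : Order.disp_t} (P : porderType disp).

Definition is_dcpo : Prop :=
  forall D : set P, directed D -> exists s, supremums D s.

Definition is_continuous_poset : Prop :=
  forall x : P,
    directed [set y | way_below y x] /\ supremums [set y | way_below y x] x.

Definition is_domain : Prop := is_continuous_poset /\ is_dcpo.

End Domains.

Record quasiMetric (R : realType) (X : Type) := QuasiMetric {
  qdist :> X -> X -> R;
  qdist_ge0 : forall x y, 0 <= qdist x y;
  qdist_eq : forall x y, x = y <-> (qdist x y = 0 /\ qdist y x = 0);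
  qdist_triangle : forall x y z, qdist x y <= qdist x z + qdist z y
}.

(* The quasi-metric is a parameter of the type so that the induced order can be
   attached to it as a canonical structure. *)
Definition formal_ball (R : realType) (X : Type) (d : quasiMetric R X) : Type :=
  (X * {nonneg R})%type.

Section FormalBallOrder.
Variables (R : realType) (X : Type) (d : quasiMetric R X).
Implicit Types b c : formal_ball d.

HB.instance Definition _ := gen_eqMixin (formal_ball d).
HB.instance Definition _ := gen_choiceMixin (formal_ball d).

Definition fb_le b c : bool := d b.1 c.1 <= b.2%:num - c.2%:num.

Lemma fb_le_refl : reflexive fb_le.
Proof.
move=> b; rewrite /fb_le subrr.
by have /(qdist_eq d)[-> _] : b.1 = b.1 by [].
Qed.

Lemma fb_le_anti : antisymmetric fb_le.
Proof.
move=> [x r] [y s]; rewrite /fb_le /= => /andP[xy yx].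
have dxy := qdist_ge0 d x y; have dyx := qdist_ge0 d y x.
have rs : r%:num = s%:num by lra.
have -> : x = y by apply/(qdist_eq d); split; lra.
by congr pair; apply/val_inj.
Qed.

Lemma fb_le_trans : transitive fb_le.
Proof.
move=> [y s] [x r] [z t]; rewrite /fb_le /= => xy yz.
have := qdist_triangle d x z y; lra.
Qed.

Fact fb_display : Order.disp_t. Proof. exact: Order.Disp tt tt. Qed.

HB.instance Definition _ := Order.Le_isPOrder.Build fb_display (formal_ball d)
  fb_le_refl fb_le_anti fb_le_trans.

Lemma fb_leE b c : (b <= c)%O = (d b.1 c.1 <= b.2%:num - c.2%:num).
Proof. by []. Qed.

End FormalBallOrder.

Inductive word (Sigma : Type) : Type :=
| Fin of seq Sigma
| Inf of (nat -> Sigma).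

Section Words.
Variables (R : realType) (Sigma : Type).
Implicit Types x y z : word Sigma.

(* None stands for infinite length. *)
Definition wlength x : option nat :=
  match x with Fin u => Some (size u) | Inf _ => None end.

Definition wprefix x y : Prop :=
  match x, y with
  | Fin u, Fin v => exists w, v = u ++ w
  | Fin u, Inf g => u = mkseq g (size u)
  | Inf f, _ => y = Inf f
  end.

Definition two_expN (l : option nat) : R :=
  match l with Some n => 2 ^- n | None => 0 end.

Definition qb_dist x y : R :=
  if `[< wprefix x y >] then two_expN (wlength x) - two_expN (wlength y) else 1.

Lemma wprefix_refl x : wprefix x x.
Proof. by case: x => [u|f] //=; exists [::]; rewrite cats0. Qed.

Lemma wprefix_trans y x z : wprefix x y -> wprefix y z -> wprefix x z.
Proof.
case: x => [u|f]; case: y => [v|g] //=; last first.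
- by move=> [->].
- move=> uE ->; exact: uE.
case: z => [w|h] /= [v' ->].
  by move=> [w' ->]; exists (v' ++ w'); rewrite catA.
move=> /(congr1 (take (size u))); rewrite take_size_cat // size_cat.
by rewrite /mkseq -map_take take_iota (minn_idPl _) ?leq_addr.
Qed.

Lemma two_expN_ge0 l : 0 <= two_expN l.
Proof. by case: l => //= n; rewrite invr_ge0 exprn_ge0. Qed.

Lemma two_expN_gt0 n : 0 < two_expN (Some n).
Proof. by rewrite /= invr_gt0 exprn_gt0. Qed.

Lemma two_expN_le1 l : two_expN l <= 1.
Proof. by case: l => [n|] //=; rewrite invf_le1 ?exprn_gt0 ?exprn_ege1 ?ler1n. Qed.

Lemma wprefix_two_expN x y : wprefix x y ->
  two_expN (wlength y) <= two_expN (wlength x).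
Proof.
case: x => [u|f]; case: y => [v|g] //=.
- move=> [w ->]; rewrite lef_pV2 ?posrE ?exprn_gt0 //.
  by rewrite ler_eXn2l ?ltr1n // size_cat leq_addr.
Qed.

Lemma wprefix_eq x y : wprefix x y ->
  two_expN (wlength x) = two_expN (wlength y) -> x = y.
Proof.
case: x => [u|f]; case: y => [v|g] //=.
- move=> [w ->] /invr_inj /(ieexprIn (ltr0n _ 2)) E.
  have : size u = size (u ++ w) by apply: E; rewrite gt_eqF ?ltr1n.
  rewrite size_cat -[LHS]addn0 => /addnI/esym/size0nil ->.
  by rewrite cats0.
- by move=> _ /eqP; rewrite gt_eqF // invr_gt0 exprn_gt0.
Qed.

Lemma qb_dist_ge0 x y : 0 <= qb_dist x y.
Proof. by rewrite /qb_dist; case: asboolP => // /wprefix_two_expN; lra. Qed.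

Lemma qb_dist_eq x y : x = y <-> (qb_dist x y = 0 /\ qb_dist y x = 0).
Proof.
split=> [->|[]]; rewrite /qb_dist.
  by rewrite asboolT ?subrr //; exact: wprefix_refl.
case: asboolP => [xy E _|]; last by move=> _ /eqP; rewrite oner_eq0.
by apply: wprefix_eq => //; lra.
Qed.

Lemma qb_dist_triangle x y z : qb_dist x y <= qb_dist x z + qb_dist z y.
Proof.
have := qb_dist_ge0 x z; have := qb_dist_ge0 z y; rewrite /qb_dist.
have := two_expN_ge0 (wlength y); have := two_expN_le1 (wlength x).
case: (asboolP (wprefix x z)) => xz; case: (asboolP (wprefix z y)) => zy;
  case: (asboolP (wprefix x y)) => xy; try lra.
by case: xy; exact: wprefix_trans xz zy.
Qed.

Definition qb : quasiMetric R (word Sigma) :=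
  QuasiMetric qb_dist_ge0 qb_dist_eq qb_dist_triangle.

End Words.

(* Main.v *)
(* Radii decrease along the order of formal balls, and a step to a center that
   is not an extension costs at least 1 in radius.  Hence in a directed family,
   as soon as the radius is within 1 of its infimum r, centers only grow for the
   prefix order; they have a supremum w, and (w, r) is the least upper bound.
   For continuity, (x, r) is the supremum of the chain of balls centered at the
   truncations of x to length n, with radius 2^-n above the largest one allowed;
   these are way below (x, r) because a directed family of words
   eventually extends each finite truncation of its supremum. *)
Require Import Defs.
From mathcomp Require Import lra.

Set Implicit Arguments.
Unset Strict Implicit.
Unset Printing Implicit Defensive.

Import Order.TTheory GRing.Theory Num.Theory.

Local Open Scope classical_set_scope.
Local Open Scope ring_scope.

(** * Directed sets and the way-below relation *)

Section Posets.
Context {disp : Order.disp_t} {P : porderType disp}.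
Implicit Types (D : set P) (x y s : P).

Lemma directed_ub2 D x y : directed D -> D x -> D y ->
  exists u, [/\ D u, (x <= u)%O & (y <= u)%O].
Proof.
move=> [_ dD] Dx Dy; have [|u Du ubu] := dD [set x; y] (finite_set2 _ _).
  by move=> _ [->|->].
by exists u; split=> //; apply: ubu; [left|right].
Qed.

Lemma directed_of_ub2 D : D !=set0 ->
  (forall x y, D x -> D y -> exists u, [/\ D u, (x <= u)%O & (y <= u)%O]) ->
  directed D.
Proof.
move=> D0 dD; split=> // F /finite_seqP[s ->].
elim: s => [|a s IH] sD.
  by case: D0 => u Du; exists u => // v.
have [|v Dv ubv] := IH; first by move=> z zs; apply: sD; rewrite /= inE zs orbT.
have [|u [Du au vu]] := dD a v _ Dv; first by apply: sD; rewrite /= mem_head.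
exists u => // z; rewrite /= inE => /orP[/eqP->//|zs].
exact: le_trans (ubv z zs) vu.
Qed.

Lemma way_below_le x y : way_below x y -> (x <= y)%O.
Proof.
move=> /(_ [set y] y)[| |//|_ -> //].
  by split=> [|F _ Fy]; exists y => //= z /Fy ->.
by split=> [z ->|z /(_ y erefl)].
Qed.

Lemma supremums_unique D s t : supremums D s -> supremums D t -> s = t.
Proof. by move=> [us ls] [ut lt]; apply/le_anti/andP; split; [exact: ls|exact: lt]. Qed.

(** Reduces continuity at [x] to one directed family [D] way below [x]: testing [y] and [z] way
    below [x] against [D] itself puts them below members of [D], and these have a common upper bound
    in [D]. *)
Lemma directed_way_below D x : directed D -> (forall y, D y -> way_below y x) ->
  supremums D x ->
  directed [set y | way_below y x] /\ supremums [set y | way_below y x] x.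
Proof.
move=> dD Dx sD; split.
  apply: directed_of_ub2 => [|y z yx zx].
    by case: dD.1 => y Dy; exists y; exact: Dx.
  have [u Du yu] := yx D x dD sD (lexx _).
  have [v Dv zv] := zx D x dD sD (lexx _).
  have [w [Dw uw vw]] := directed_ub2 dD Du Dv.
  by exists w; split; [exact: Dx|exact: le_trans uw|exact: le_trans vw].
split=> [y|y uy]; first exact: way_below_le.
by apply: sD.2 => z Dz; apply: uy; exact: Dx.
Qed.

End Posets.

(** * Powers of one half *)

Section HalfPowers.
Variable R : realType.

Lemma exp2VN_gt0 n : 0 < 2 ^- n :> R.
Proof. exact: two_expN_gt0. Qed.

Lemma exp2VN_le n m : (n <= m)%N -> 2 ^- m <= 2 ^- n :> R.
Proof. by move=> nm; rewrite lef_pV2 ?posrE ?exprn_gt0// ler_eXn2l ?ltr1n. Qed.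

(** Passage to the limit: since [k < 2 ^ k], the error drops below any [e > 0]. The threshold [m]
    serves estimates valid only for large [n]. *)
Lemma le_exp2VN (a x y : R) m : 0 <= a ->
  (forall n, (m <= n)%N -> x <= y + a * 2 ^- n) -> x <= y.
Proof.
move=> a0 H; apply/ler_addgt0Pr => e e0.
set k := Num.bound (a / e).
apply: le_trans (H (maxn m k) (leq_maxl _ _)) _; rewrite lerD2l.
apply: le_trans (_ : a * 2 ^- k <= e).
  by rewrite ler_wpM2l// exp2VN_le// leq_maxr.
rewrite ler_pdivrMr ?exprn_gt0// mulrC -ler_pdivrMr//.
apply: le_trans (ltW (archi_boundP _)) _; first by rewrite divr_ge0// ltW.
by rewrite -natrX ler_nat ltnW// ltn_expl.
Qed.

End HalfPowers.

(** * Words as partial functions, truncations and suprema *)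

Section WordPrefix.
Variable Sigma : Type.
Implicit Types x y z w : word Sigma.

Definition wonth x (n : nat) : option Sigma :=
  match x with Fin u => onth u n | Inf f => Some (f n) end.

Definition wtake (n : nat) x : word Sigma :=
  match x with Fin u => Fin (take n u) | Inf f => Fin (mkseq f n) end.

Lemma onth_mkseq (f : nat -> Sigma) n m :
  onth (mkseq f n) m = if (m < n)%N then Some (f m) else None.
Proof.
case: ifP => mn; last by apply: onth_default; rewrite size_mkseq leqNgt mn.
rewrite onthE (nth_map (f 0%N)) ?size_mkseq// nth_mkseq//.
Qed.

Lemma onth_take (u : seq Sigma) n m :
  onth (take n u) m = if (m < n)%N then onth u m else None.
Proof.
case: ifP => mn; last first.
  by apply: onth_default; rewrite size_take_min geq_min leqNgt mn.
by rewrite !onthE map_take nth_take.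
Qed.

Lemma wonth_wtake n x m :
  wonth (wtake n x) m = if (m < n)%N then wonth x m else None.
Proof. by case: x => [u|f] /=; rewrite ?onth_take ?onth_mkseq. Qed.

(** Turns the prefix order into inclusion of partial functions, treating finite and infinite words
    alike. *)
Lemma wprefixP x y :
  wprefix x y <-> forall n a, wonth x n = Some a -> wonth y n = Some a.
Proof.
case: x y => [u|f] [v|g] /=; split.
- move=> [w ->] n a una; rewrite onth_cat ifT//.
  by rewrite -onthTE una.
- move=> H; exists (drop (size u) v); rewrite -[LHS](cat_take_drop (size u)).
  congr (_ ++ _); apply: eq_from_onth => i; rewrite onth_take.
  case: ltnP => iu; last by rewrite onth_default.
  by case E : (onth u i) (onthTE u i) => [a|]; [rewrite (H _ _ E)|rewrite iu].
- by move=> -> n a; rewrite onth_mkseq; case: ifP.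
- move=> H; apply: eq_from_onth => i; rewrite onth_mkseq.
  case: ltnP => iu; last by rewrite onth_default.
  by case E : (onth u i) (onthTE u i) => [a|]; [rewrite (H _ _ E)|rewrite iu].
- by [].
- by move=> /(_ (size v) _ erefl); rewrite onth_default.
- by move=> [->].
- by move=> H; congr Inf; apply/funext => n; have [] := H n _ erefl.
Qed.

Lemma wtake_wprefix n x : wprefix (wtake n x) x.
Proof. by apply/wprefixP => m a; rewrite wonth_wtake; case: ifP. Qed.

Lemma wtake_mono n m x : (n <= m)%N -> wprefix (wtake n x) (wtake m x).
Proof.
move=> nm; apply/wprefixP => k a; rewrite !wonth_wtake.
by case: ifP => // kn; rewrite (leq_trans kn nm).
Qed.

Lemma wprefix_wtake n x y : wprefix x y -> wprefix (wtake n x) (wtake n y).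
Proof.
move=> /wprefixP xy; apply/wprefixP => k a; rewrite !wonth_wtake.
by case: ifP => // _; exact: xy.
Qed.

Lemma wprefix_of_wtake x y : (forall n, wprefix (wtake n x) y) -> wprefix x y.
Proof.
move=> H; apply/wprefixP => n a xna; have /wprefixP := H n.+1; apply.
by rewrite wonth_wtake ltnSn.
Qed.

(** A truncation either has length exactly [n] or leaves the word unchanged. *)
Lemma two_expN_wtake (R : realType) n x :
  two_expN R (wlength (wtake n x)) <= two_expN R (wlength x) + 2 ^- n.
Proof.
case: x => [u|f] /=; last by rewrite size_mkseq add0r.
have := exp2VN_gt0 R (size u); have := exp2VN_gt0 R n.
by rewrite size_take_min /minn; case: ifP => _; lra.
Qed.

(** The domain of [p] is an initial segment: if it is everything the word is infinite, otherwise the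
    least undefined index is its length. *)
Lemma word_of_wonth (p : nat -> option Sigma) :
  (forall n, p n.+1 -> p n) -> exists w, wonth w =1 p.
Proof.
move=> pS; have [allp|] := pselect (forall n, p n).
  have /boolp.choice[f pf] : forall n, exists a, p n = Some a.
    by move=> n; case: (p n) (allp n) => // a _; exists a.
  by exists (Inf f) => n /=; rewrite pf.
move=> /existsNP[n /negP npn].
have : exists n, ~~ p n by exists n.
move=> /ex_minnP[N pN minN].
have pNone k : (N <= k)%N -> p k = None.
  have pk_pN i j : p (i + j)%N -> p i.
    by elim: j => [|j IH]; rewrite ?addn0// addnS => /pS/IH.
  move=> Nk; case E : (p k) => [a|] //.
  by move: pN; rewrite (pk_pN N (k - N)%N)// subnKC// E.
have pSome k : (k < N)%N -> p k.
  by move=> kN; apply: contraTT kN => /minN; rewrite -leqNgt.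
case: (posnP N) => [N0|N0].
  by exists (Fin [::]) => k /=; rewrite onth0n pNone// N0.
(* [odflt] needs a letter, taken from [p 0]; hence length 0 was split off. *)
have [a0 _] : exists a, p 0%N = Some a by case: (p 0%N) (pSome 0%N N0) => // a; exists a.
exists (Fin (mkseq (fun k => odflt a0 (p k)) N)) => k /=; rewrite onth_mkseq.
case: ltnP => [kN|/pNone//].
by case: (p k) (pSome k kN).
Qed.

Lemma wonthS x n : wonth x n.+1 -> wonth x n.
Proof. by case: x => [u|f] //; rewrite /wonth !onthTE; exact: ltnW. Qed.

(** Directedness makes members agree wherever they have a letter, so their union is a word. By
    induction on [n], a member covering the first [n] letters is joined with one having the next
    letter. *)
Lemma wprefix_directed_sup (S : set (word Sigma)) : S !=set0 ->
  (forall x y, S x -> S y -> exists z, [/\ S z, wprefix x z & wprefix y z]) ->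
  exists w, (forall x, S x -> wprefix x w) /\
            (forall n, exists2 x, S x & wprefix (wtake n w) x).
Proof.
move=> S0 dS.
pose g n a := exists2 x, S x & wonth x n = Some a.
have gfun n a b : g n a -> g n b -> a = b.
  move=> [x Sx xa] [y Sy yb]; have [z [_ /wprefixP xz /wprefixP yz]] := dS x y Sx Sy.
  by have := xz _ _ xa; rewrite (yz _ _ yb) => -[].
have /boolp.choice[p pg] : forall n, exists o, forall a, o = Some a <-> g n a.
  move=> n; have [[a ga]|ng] := pselect (exists a, g n a).
    by exists (Some a) => b; split=> [[<-]//|gb]; congr Some; exact: gfun ga gb.
  by exists None => b; split=> // gb; case: ng; exists b.
have [n|w wp] := @word_of_wonth p.
  case E : (p n.+1) => [a|] // _; have [x Sx xa] := (pg _ _).1 E.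
  have : wonth x n by apply: wonthS; rewrite xa.
  case E' : (wonth x n) => [b|] // _.
  by rewrite ((pg n b).2 _)//; exists x.
exists w; split=> [x Sx|n].
  by apply/wprefixP => n a xa; rewrite wp; apply/pg; exists x.
elim: n => [|n [x Sx /wprefixP wx]].
  by case: S0 => x Sx; exists x => //; apply/wprefixP => k a; rewrite wonth_wtake.
case E : (p n) => [a|].
  have [y Sy ya] := (pg _ _).1 E.
  have [z [Sz /wprefixP xz /wprefixP yz]] := dS x y Sx Sy.
  exists z => //; apply/wprefixP => k b; rewrite wonth_wtake ltnS leq_eqVlt.
  case: eqP => [->|_] /=.
    by rewrite wp E => -[<-]; exact: yz.
  by move=> wk; apply: xz; apply: wx; rewrite wonth_wtake.
exists x => //; apply/wprefixP => k b; rewrite wonth_wtake ltnS leq_eqVlt.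
case: eqP => [->|_] /=; first by rewrite wp E.
by move=> wk; apply: wx; rewrite wonth_wtake.
Qed.

End WordPrefix.

(** * Suprema and approximation of formal balls *)

Section FormalBallsOfWords.
Variables (R : realType) (Sigma : Type).
Local Notation ball := (formal_ball (qb R Sigma)).
Local Notation weight x := (two_expN R (wlength x)).
Implicit Types (b c : ball) (D : set ball).

(** The second alternative can omit the failure of the prefix relation because the distance never
    exceeds 1. *)
Lemma ball_leP b c : (b <= c)%O <->
  (wprefix b.1 c.1 /\ weight b.1 - weight c.1 <= b.2%:num - c.2%:num) \/
  1 <= b.2%:num - c.2%:num.
Proof.
rewrite fb_leE /= /qb_dist; case: asboolP => p; split=> H.
- by left.
- have := two_expN_le1 R (wlength b.1); have := two_expN_ge0 R (wlength c.1).
  by case: H => [[_]//|]; lra.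
- by right.
- by case: H => [[]|].
Qed.

Lemma ball_le_radius b c : (b <= c)%O -> c.2%:num <= b.2%:num.
Proof. by rewrite fb_leE => H; have := le_trans (qdist_ge0 _ _ _) H; lra. Qed.

(** The second conclusion is what the way-below proof uses: a single member of [D] is close to the
    supremum in both center and radius. *)
Lemma directed_ball_sup D : directed D -> exists b, supremums D b /\
  forall n, exists c, [/\ D c, wprefix c.1 b.1, wprefix (wtake n b.1) c.1 &
                         c.2%:num <= b.2%:num + 2 ^- n].
Proof.
move=> dD; pose E := [set c.2%:num | c in D].
have E0 : E !=set0 by case: dD.1 => c Dc; exists c.2%:num, c.
have E_ge0 : lbound E 0 by move=> _ [c _ <-].
have Einf : has_inf E by split=> //; exists 0.
have r_ge0 : 0 <= inf E by exact: lb_le_inf.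
have r_le c : D c -> inf E <= c.2%:num.
  by move=> Dc; apply: ge_inf; [exists 0|exists c].
have r_adh e : 0 < e -> exists2 c, D c & c.2%:num < inf E + e.
  by move=> /inf_adherent /(_ Einf)[_ [c Dc <-]]; exists c.
have [b0 Db0 b0r] := r_adh 1 ltr01.
have tail b c : D b -> D c -> (b0 <= b)%O -> (b <= c)%O ->
    wprefix b.1 c.1 /\ weight b.1 - weight c.1 <= b.2%:num - c.2%:num.
  move=> Db Dc /ball_le_radius b0b /ball_leP[//|].
  by have := r_le _ Dc; lra.
pose S := [set c.1 | c in [set c | D c /\ (b0 <= c)%O]].
have [||w [Sw wS]] := @wprefix_directed_sup _ S.
- by exists b0.1, b0 => //; split.
- move=> _ _ [b [Db b0b] <-] [c [Dc b0c] <-].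
  have [u [Du bu cu]] := directed_ub2 dD Db Dc.
  have b0u := le_trans b0b bu.
  by exists u.1; split; [exists u|apply: (tail _ _ Db Du _ _).1|
    apply: (tail _ _ Dc Du _ _).1].
(* Directedness merges three members: one extending the truncation of [w], one of nearly minimal
   radius, and [b]. *)
have approx b n : D b -> exists c, [/\ D c, (b0 <= c)%O, (b <= c)%O,
    wprefix (wtake n w) c.1 & c.2%:num <= inf E + 2 ^- n].
  move=> Db; have [_ [c [Dc b0c] <-] wc] := wS n.
  have [d Dd dr] := r_adh _ (exp2VN_gt0 R n).
  have [u [Du cu du]] := directed_ub2 dD Dc Dd.
  have [v [Dv uv bv]] := directed_ub2 dD Du Db.
  have cv := le_trans cu uv.
  exists v; split=> //; first exact: le_trans cv.
    by apply: wprefix_trans wc _; exact: (tail _ _ Dc Dv b0c cv).1.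
  exact: le_trans (ball_le_radius (le_trans du uv)) (ltW dr).
pose s : ball := (w, NngNum r_ge0).
have tailP b : D b -> (b0 <= b)%O -> wprefix b.1 w /\
    weight b.1 - weight w <= b.2%:num - inf E.
  move=> Db b0b; split; first by apply: Sw; exists b.
  apply: (@le_exp2VN R 1 _ _ 0) => // n _.
  have [c [Dc b0c bc wc cr]] := approx b n Db.
  have [_] := tail _ _ Db Dc b0b bc.
  have := wprefix_two_expN R wc; have := two_expN_wtake R n w.
  by have := r_le _ Dc; lra.
have ubs : ubound D s.
  move=> b Db; have [c [Dc b0c bc _ _]] := approx b 0%N Db.
  by apply: le_trans bc _; apply/ball_leP; left; exact: tailP.
exists s; split; last first.
  move=> n; have [c [Dc b0c _ wc cr]] := approx b0 n Db0.
  by exists c; split=> //; exact: (tailP c _ _).1.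
split=> // t ubt; apply/ball_leP => /=.
have [H|] := pselect (forall c, D c -> (b0 <= c)%O -> wprefix c.1 t.1).
  left; split.
    apply: wprefix_of_wtake => n; have [c [Dc b0c _ wc _]] := approx b0 n Db0.
    by apply: wprefix_trans wc _; exact: H.
  apply: (@le_exp2VN R 1 _ _ 0) => // n _.
  have [c [Dc b0c _ wc cr]] := approx b0 n Db0.
  have := wprefix_two_expN R (tailP c Dc b0c).1.
  have := ubt _ Dc => /ball_leP[[_]|]; first lra.
  have := two_expN_le1 R (wlength w); have := two_expN_ge0 R (wlength t.1); lra.
(* Members above [b] also fail to have centers that are prefixes of [t.1], so their radii exceed
   that of [t] by at least 1; the limit keeps this bound. *)
move=> /existsNP[b /not_implyP[Db /not_implyP[b0b nbt]]]; right.
apply: (@le_exp2VN R 1 _ _ 0) => // n _.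
have [c [Dc b0c bc wc cr]] := approx b n Db.
have := ubt _ Dc => /ball_leP[[ct _]|]; last lra.
by case: nbt; apply: wprefix_trans ct; exact: (tail _ _ Db Dc b0b bc).1.
Qed.

Definition ball_approx_radius b n : R :=
  b.2%:num + (weight (wtake n b.1) - weight b.1) + 2 ^- n.

Lemma ball_approx_radius_ge0 b n : 0 <= ball_approx_radius b n.
Proof.
have := wprefix_two_expN R (wtake_wprefix n b.1); have := exp2VN_gt0 R n.
have : 0 <= b.2%:num by [].
by rewrite /ball_approx_radius; lra.
Qed.

(* The ball centered at [wtake n b.1] with the largest radius for which it lies
   below b, enlarged by 2^-n to make it way below b. *)
Definition ball_approx b n : ball :=
  (wtake n b.1, NngNum (ball_approx_radius_ge0 b n)).

(** The slack [2 ^- n] in the radius absorbs the error with which a member of [D] attains the radius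
    of the supremum. *)
Lemma ball_approx_way_below b n : way_below (ball_approx b n) b.
Proof.
move=> D s dD sD bs; have [t [tD H]] := directed_ball_sup dD.
move: bs; rewrite (supremums_unique sD tD) {s sD} => bt.
have [c [Dc ct tc cr]] := H n; exists c => //.
have wc := wprefix_two_expN R ct.
have wb := wprefix_two_expN R (wtake_wprefix n b.1).
apply/ball_leP; rewrite /= /ball_approx_radius.
case/ball_leP: bt => [[bt le_bt]|le_bt]; last by right; lra.
left; split; last lra.
exact: wprefix_trans (wprefix_wtake n bt) tc.
Qed.

Lemma ball_approx_mono b n m : (n <= m)%N -> (ball_approx b n <= ball_approx b m)%O.
Proof.
move=> nm; apply/ball_leP; left; split; first exact: wtake_mono.
by rewrite /= /ball_approx_radius; have := exp2VN_le R nm; lra.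
Qed.

Lemma ball_approx_supremum b : supremums (range (ball_approx b)) b.
Proof.
split=> [_ [n _ <-]|t ubt]; first exact/way_below_le/ball_approx_way_below.
apply/ball_leP.
have le_t n : (ball_approx b n <= t)%O by apply: ubt; exists n.
have [H|/existsNP[n nt]] := pselect (forall n, wprefix (wtake n b.1) t.1).
  left; split; first exact: wprefix_of_wtake.
  apply: (@le_exp2VN R 1 _ _ 0) => // n _.
  have /= := le_t n; rewrite fb_leE /= /qb_dist asboolT// /ball_approx_radius; lra.
(* The factor 2 counts one [2 ^- m] from truncating and one from the added slack; only [m] at least
   [n] are used, since longer truncations still fail to be prefixes. *)
right; apply: (@le_exp2VN R 2 _ _ n) => // m nm.
have /ball_leP[[mt _]|] := le_t m.
  by case: nt; apply: wprefix_trans mt; exact: wtake_mono.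
by rewrite /= /ball_approx_radius; have := two_expN_wtake R m b.1; lra.
Qed.

Lemma ball_approx_directed b : directed (range (ball_approx b)).
Proof.
apply: directed_of_ub2; first by exists (ball_approx b 0%N), 0%N.
move=> _ _ [n _ <-] [m _ <-]; exists (ball_approx b (maxn n m)).
by split; [exists (maxn n m)|apply: ball_approx_mono; rewrite leq_maxl|
  apply: ball_approx_mono; rewrite leq_maxr].
Qed.

End FormalBallsOfWords.

Theorem mainTheorem1 (R : realType) (Sigma : Type) (Sigma_nonempty : inhabited Sigma) :
  is_domain (formal_ball (qb R Sigma)).
Proof.
split=> [b|D dD]; last by have [b [sD _]] := directed_ball_sup dD; exists b.
apply: directed_way_below (ball_approx_directed b) _ (ball_approx_supremum b).
by move=> _ [n _ <-]; exact: ball_approx_way_below.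
Qed.
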